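(* Let $\alpha\neq 0$ be a real number and let $\vec v\in\mathbb R_1^3$. If $\Sigma\subset\mathbb R_1^3$ is a spacelike surface of revolution with spacelike rotation axis that is a $K^\alpha$-translator with speed $\vec v$, then $\vec v$ is parallel to the rotation axis of $\Sigma$.
   Context: $\mathbb R_1^3$ is $\mathbb R^3$ with the metric $\langle,\rangle=dx^2+dy^2-dz^2$. A surface is spacelike if its induced metric is Riemannian; then its unit normal $N$ satisfies $\langle N,N\rangle=\epsilon=-1$. The Gauss curvature is $K=\epsilon\det(A)$, where $AU=-\nabla^0_U N$ is the Weingarten map and $\nabla^0$ is the Levi-Civita connection of $\mathbb R_1^3$. In a local parametrization $X(u,v)$, $$K=-\frac{\det(X_u,X_v,X_{uu})\det(X_u,X_v,X_{vv})-\det(X_u,X_v,X_{uv})^2}{(EG-F^2)^2},$$ where $E=\langle X_u,X_u\rangle$, $F=\langle X_u,X_v\rangle$, $G=\langle X_v,X_v\rangle$. A spacelike surface is a $K^\alpha$-translator with speed $\vec v$ if $K>0$ and $K^\alpha=\langle N,\vec v\rangle$ everywhere, for a choice of unit normal $N$. A surface of revolution with spacelike axis is, after a rigid motion of $\mathbb R_1^3$, one whose axis is the $x$-axis, parametrized either by $X(r,\theta)=(f(r),r\sinh\theta,r\cosh\theta)$ or by $X(r,\theta)=(f(r),r\cosh\theta,r\sinh\theta)$, with $f$ smooth on an interval of $r>0$. The first is spacelike iff $f'^2>1$; the second is always timelike, so spacelike surfaces are of the first kind. *)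

(* Defs.v *)
From HB Require Import structures.
From mathcomp Require Import all_boot all_order all_algebra.
From mathcomp Require Import all_classical all_reals all_analysis.
Import Order.TTheory GRing.Theory Num.Theory.
Import numFieldNormedType.Exports.

Set Implicit Arguments.
Unset Strict Implicit.
Unset Printing Implicit Defensive.

Local Open Scope classical_set_scope.
Local Open Scope ring_scope.

Section Minkowski.
Context {R : realType}.
Implicit Types x y : 'rV[R]_3.

Definition mink x y : R := x 0 0 * y 0 0 + x 0 1 * y 0 1 - x 0 2 * y 0 2.

Definition vec3 (a b c : R) : 'rV[R]_3 := \row_(i < 3) [:: a; b; c]`_i.

(* Vectors are rows, so the rigid motions of Minkowski space are the maps
   x |-> o + x *m L with [lorentz L]. *)
Definition lorentz (L : 'M[R]_3) : Prop :=
  forall x y, mink (x *m L) (y *m L) = mink x y.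

Definition sinh (t : R) : R := (expR t - expR (- t)) / 2.
Definition cosh (t : R) : R := (expR t + expR (- t)) / 2.

Definition smooth_on (I : set R) (f : R -> R) : Prop :=
  forall n t, I t -> derivable (derive1n n f) t 1.

End Minkowski.

(* A surface is given by a parametrization X : (s, t) |-> X s t over a domain
   D of parameters; points outside D are irrelevant. *)
Section Surfaces.
Context {R : realType}.
Implicit Types (D : set (R * R)) (X N : R -> R -> 'rV[R]_3) (s t : R).

Definition pderiv1 X s t : 'rV[R]_3 := derive1 (fun s' => X s' t) s.
Definition pderiv2 X s t : 'rV[R]_3 := derive1 (fun t' => X s t') t.

(* The 2 x 3 matrix with rows X_s and X_t. For w : 'rV_2, the tangent vector
   with coordinates w in the basis (X_s, X_t) is w *m Jac X s t. *)
Definition Jac X s t : 'M[R]_(2, 3) :=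
  \matrix_(i < 2) (if i == 0 then pderiv1 X s t else pderiv2 X s t).

Definition spacelike D X : Prop :=
  forall s t, D (s, t) -> forall w : 'rV[R]_2, w != 0 ->
    0 < mink (w *m Jac X s t) (w *m Jac X s t).

(* The first three clauses determine N up to sign at each point of a spacelike
   surface; separate differentiability then forces the sign to be locally
   constant, so that N is as regular as the tangent planes. *)
Definition unit_normal D X N : Prop :=
  forall s t, D (s, t) ->
    [/\ mink (N s t) (N s t) = -1,
        mink (N s t) (pderiv1 X s t) = 0,
        mink (N s t) (pderiv2 X s t) = 0,
        derivable (fun s' => N s' t) s 1
      & derivable (fun t' => N s t') t 1].

(* The Levi-Civita connection of Minkowski space is the componentwise
   derivative, so the derivative of N along the tangent vector w *m Jac X s t
   is w *m Jac N s t. Hence A is the matrix, acting on rows of coordinates in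
   the basis (X_s, X_t), of the Weingarten map U |-> - nabla_U N. *)
Definition weingarten X N s t (A : 'M[R]_2) : Prop :=
  A *m Jac X s t = - Jac N s t.

(* K = eps * det A with eps = <N, N>. The matrix A exists and is unique when N
   is a unit normal of a spacelike surface. *)
Definition gauss_curvature X N s t (K : R) : Prop :=
  exists2 A, weingarten X N s t A & K = mink (N s t) (N s t) * \det A.

Definition K_translator D X (alpha : R) (v : 'rV[R]_3) : Prop :=
  exists N, unit_normal D X N /\
    forall s t, D (s, t) ->
      exists K, [/\ gauss_curvature X N s t K,
                    0 < K & K `^ alpha = mink (N s t) v].

End Surfaces.

Section Revolution.
Context {R : realType}.

Definition rev_cosh (f : R -> R) (r theta : R) : 'rV[R]_3 :=
  vec3 (f r) (r * sinh theta) (r * cosh theta).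

Definition rev_sinh (f : R -> R) (r theta : R) : 'rV[R]_3 :=
  vec3 (f r) (r * cosh theta) (r * sinh theta).

Definition rev_domain (I : set R) : set (R * R) := I `*` setT.

(* X parametrizes, over [rev_domain I], a surface of revolution whose axis is
   the spacelike line through o with direction a: the image of the x-axis by
   the rigid motion x |-> o + x *m L. *)
Definition revolution_surface (o a : 'rV[R]_3) (I : set R)
    (X : R -> R -> 'rV[R]_3) : Prop :=
  [/\ open I, is_interval I, I !=set0, I `<=` [set r | 0 < r] &
   exists (L : 'M[R]_3) (f : R -> R),
     [/\ lorentz L, a = vec3 1 0 0 *m L, smooth_on I f &
         (forall r theta, I r -> X r theta = o + rev_cosh f r theta *m L) \/
         (forall r theta, I r -> X r theta = o + rev_sinh f r theta *m L)]].

Definition parallel (v a : 'rV[R]_3) : Prop := exists c : R, v = c *: a.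

End Revolution.

(* Main.v *)
(* A rigid motion brings the axis to the x-axis; the second kind of surface is
   then timelike, since X_theta is. On the surface (f r, r sinh t, r cosh t) the
   unit normal is N = n (1, f' sinh t, f' cosh t) with n^2 (f'^2 - 1) = 1, so n
   (being differentiable) and K = f' f'' / (r (f'^2 - 1)^2) depend on r only. For
   fixed r the translator equation K^alpha = n (w0 + f' (w1 sinh t - w2 cosh t))
   thus makes w1 sinh t - w2 cosh t constant in t, whence w1 = w2 = 0. *)
Require Import Defs.
From mathcomp Require Import all_boot all_order all_algebra.
From mathcomp Require Import all_classical all_reals all_analysis.
From mathcomp Require Import ring lra.
Import Order.TTheory GRing.Theory Num.Theory.
Import numFieldNormedType.Exports.
Set Implicit Arguments.
Unset Strict Implicit.
Unset Printing Implicit Defensive.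

Local Open Scope classical_set_scope.
Local Open Scope ring_scope.

(** * Entrywise differentiation of matrix-valued maps *)

Lemma is_derive_mxP (R : realFieldType) (V : normedModType R) (m n : nat)
    (M : V -> 'M[R]_(m, n)) (dM : 'M[R]_(m, n)) (x v : V) :
  is_derive x v M dM <->
  forall i j, is_derive x v (fun y => M y i j) (dM i j).
Proof.
split=> [[Mx <-] i j|dMij].
  rewrite derive_mx// mxE; apply/derivableP.
  by have /derivable_mxP := Mx; apply.
have Mx : derivable M x v.
  by apply/derivable_mxP => i j; have [] := dMij i j.
apply: DeriveDef => //; rewrite derive_mx//; apply/matrixP => i j.
by rewrite mxE; have [] := dMij i j.
Qed.

Lemma is_derive_mulmxr (R : realFieldType) (V : normedModType R) (m n p : nat)
    (M : V -> 'M[R]_(m, n)) (dM : 'M[R]_(m, n)) (L : 'M[R]_(n, p)) (x v : V) :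
  is_derive x v M dM -> is_derive x v (fun y => M y *m L) (dM *m L).
Proof.
move=> /is_derive_mxP dMij; apply/is_derive_mxP => i j.
rewrite (_ : (fun _ => _) = \sum_k (L k j \*: (fun y => M y i k))); last first.
  apply/funext => y; rewrite mxE fct_sumE.
  by apply: eq_bigr => k _ /=; rewrite mulrC.
rewrite mxE (eq_bigr (fun k => L k j *: dM i k)) => [|k _]; last exact: mulrC.
by apply: is_derive_sum => k; apply: is_deriveZ.
Qed.

Lemma derive1_val (R : realFieldType) (V : normedModType R) (f : R -> V)
    (x : R) (df : V) : is_derive x 1 f df -> derive1 f x = df.
Proof. by move=> fx; rewrite derive1E derive_val. Qed.

Lemma is_derive1_entry (R : realFieldType) (m n : nat) (M : R -> 'M[R]_(m, n))
    (x : R) i j :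
  derivable M x 1 -> is_derive x 1 (fun y => M y i j) (derive1 M x i j).
Proof. by rewrite derive1E => /derivableP/is_derive_mxP. Qed.

Lemma is_derive_unique (R : numFieldType) (V W : normedModType R) (f : V -> W)
    (x v : V) (df dg : W) :
  is_derive x v f df -> is_derive x v f dg -> df = dg.
Proof. by move=> [_ <-] [_ <-]. Qed.

Lemma is_derive_mulr (R : realFieldType) (c x : R) :
  is_derive x 1 (fun y => y * c) c.
Proof.
have := is_deriveM (is_derive_id x 1) (is_derive_cst c x 1).
by rewrite scaler0 add0r /GRing.scale/= mulr1.
Qed.

(** * Hyperbolic functions *)

Section Hyperbolic.
Variable R : realType.
Implicit Types t : R.

Lemma is_derive_expRN t : is_derive t 1 (fun x => expR (- x)) (- expR (- t)).
Proof.
have := is_derive1_comp (g := -%R) (is_derive_expR (- t)) (is_deriveNid t 1).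
by rewrite mulrN1.
Qed.

Lemma is_derive_sinh t : is_derive t 1 (@sinh R) (cosh t).
Proof.
have dN := is_derive_expRN t.
have := is_deriveZ 2^-1 (is_deriveB (is_derive_expR t) dN).
rewrite opprK /GRing.scale/= mulrC; congr is_derive.
by apply/funext => x; rewrite /sinh mulrC.
Qed.

Lemma is_derive_cosh t : is_derive t 1 (@cosh R) (sinh t).
Proof.
have dN := is_derive_expRN t.
have := is_deriveZ 2^-1 (is_deriveD (is_derive_expR t) dN).
rewrite /GRing.scale/= mulrC; congr is_derive.
by apply/funext => x; rewrite /cosh mulrC.
Qed.

Lemma cosh2B_sinh2 t : cosh t ^+ 2 - sinh t ^+ 2 = 1.
Proof.
have := expRxMexpNx_1 t; rewrite /cosh /sinh.
by move: (expR t) (expR (- t)) => p q pq; field: pq.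
Qed.

Lemma cosh_gt0 t : 0 < cosh t.
Proof. by rewrite divr_gt0// addr_gt0// expR_gt0. Qed.

Lemma sinh0 : sinh 0 = 0 :> R.
Proof. by rewrite /sinh oppr0 subrr mul0r. Qed.

Lemma cosh0 : cosh 0 = 1 :> R.
Proof. by rewrite /cosh oppr0 expR0; field. Qed.

End Hyperbolic.

(** * Coordinates in Minkowski space *)

Section Coordinates.
Variable R : realType.
Implicit Types (x y : 'rV[R]_3) (a b c : R).

Lemma vec3E a b c :
  (vec3 a b c 0 0 = a) * (vec3 a b c 0 1 = b) * (vec3 a b c 0 2 = c).
Proof. by rewrite !mxE. Qed.

Lemma rV3_eq x y : x 0 0 = y 0 0 -> x 0 1 = y 0 1 -> x 0 2 = y 0 2 -> x = y.
Proof.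
move=> e0 e1 e2; apply/rowP => -[[|[|[|//]]] i3].
- by rewrite [Ordinal i3](_ : _ = 0)//; apply: val_inj.
- by rewrite [Ordinal i3](_ : _ = 1)//; apply: val_inj.
- by rewrite [Ordinal i3](_ : _ = 2)//; apply: val_inj.
Qed.

Lemma is_derive_vec3 (f g h : R -> R) (df dg dh t : R) :
  is_derive t 1 f df -> is_derive t 1 g dg -> is_derive t 1 h dh ->
  is_derive t 1 (fun s => vec3 (f s) (g s) (h s)) (vec3 df dg dh).
Proof.
move=> fx gx hx; apply/is_derive_mxP => i j; rewrite mxE.
under eq_fun do rewrite mxE.
by case: j => -[|[|[|//]]].
Qed.

(** A row killed by [L] is orthogonal to every vector, since [L] preserves [mink]; nondegeneracy,
    tested on the standard basis, makes it zero. *)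
Lemma lorentz_unitmx (L : 'M[R]_3) : lorentz L -> L \in unitmx.
Proof.
move=> lL; rewrite -row_free_unit -kermx_eq0; apply/rowV0P => x /sub_kermxP xL0.
have x0 y : mink x y = 0 by rewrite -lL xL0 /mink !mxE !mul0r addr0 subrr.
move: (x0 (vec3 1 0 0)) (x0 (vec3 0 1 0)) (x0 (vec3 0 0 1)).
rewrite /mink !vec3E => e0 e1 e2.
by apply: rV3_eq; rewrite mxE; lra.
Qed.

End Coordinates.

(** * Matrices of size two *)

Lemma ord2P (i : 'I_2) : i = 0 \/ i = 1.
Proof. by case: i => -[|[|//]] i2; [left|right]; apply: val_inj. Qed.

Lemma sum_ord2 (V : nmodType) (F : 'I_2 -> V) : \sum_i F i = F 0 + F 1.
Proof.
rewrite big_ord_recl big_ord1; congr (F _ + F _); exact: val_inj.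
Qed.

Lemma det_mx2 (R : comNzRingType) (A : 'M[R]_2) :
  \det A = A 0 0 * A 1 1 - A 0 1 * A 1 0.
Proof.
rewrite (expand_det_row _ 0) sum_ord2 /cofactor !det_mx11 !mxE/=.
rewrite expr0 mul1r expr1 mulN1r mulrN.
by congr (_ * A _ _ - _ * A _ _); exact: val_inj.
Qed.

(** * Invariance under rigid motions *)

Section RigidMotions.
Variables (R : realType) (D : set (R * R)) (L : 'M[R]_3).
Implicit Types (X Y N : R -> R -> 'rV[R]_3) (s t : R).

Lemma JacE X s t j :
  (Jac X s t 0 j = pderiv1 X s t 0 j) * (Jac X s t 1 j = pderiv2 X s t 0 j).
Proof. by rewrite !mxE. Qed.

Lemma row_Jac X s t :
  (row 0 (Jac X s t) = pderiv1 X s t) * (row 1 (Jac X s t) = pderiv2 X s t).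
Proof. by split; apply/rowP => j; rewrite mxE JacE. Qed.

Lemma Jac_mulmx X Y s t :
  pderiv1 X s t = pderiv1 Y s t *m L -> pderiv2 X s t = pderiv2 Y s t *m L ->
  Jac X s t = Jac Y s t *m L.
Proof.
move=> X1 X2; apply/row_matrixP => i; rewrite row_mul.
by have [->|->] := ord2P i; rewrite !row_Jac.
Qed.

Lemma spacelike_mulmx X Y : lorentz L ->
  (forall s t, D (s, t) -> Jac X s t = Jac Y s t *m L) ->
  spacelike D X -> spacelike D Y.
Proof. by move=> lL XY sX s t st w /(sX s t st); rewrite XY// mulmxA lL. Qed.

(** The normal is carried back by the isometry [invmx L]. Multiplying the Weingarten equation on the
    right by [invmx L] keeps the same matrix [A], hence the same curvature. *)
Lemma K_translator_mulmx X Y (alpha : R) (v : 'rV[R]_3) : lorentz L ->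
  (forall s t, D (s, t) -> Jac X s t = Jac Y s t *m L) ->
  K_translator D X alpha v -> K_translator D Y alpha (v *m invmx L).
Proof.
move=> lL XY [N [nN KN]]; have uL := lorentz_unitmx lL.
have lV x y : mink (x *m invmx L) (y *m invmx L) = mink x y.
  by rewrite -lL !mulmxKV.
have lVl x y : mink (x *m invmx L) y = mink x (y *m L).
  by rewrite -lL mulmxKV.
have JN s t : D (s, t) ->
    Jac (fun s t => N s t *m invmx L) s t = Jac N s t *m invmx L.
  move=> /nN[_ _ _ /derivableP dN1 /derivableP dN2].
  apply/row_matrixP => i; rewrite row_mul.
  have [->|->] := ord2P i.
  - rewrite !row_Jac /pderiv1 (derive1_val (is_derive_mulmxr _ dN1)).
    by rewrite derive1E.
  - rewrite !row_Jac /pderiv2 (derive1_val (is_derive_mulmxr _ dN2)).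
    by rewrite derive1E.
exists (fun s t => N s t *m invmx L); split=> s t st.
  have [NN N1 N2 dN1 dN2] := nN s t st; split.
  - by rewrite lV.
  - by rewrite lVl -[pderiv1 Y s t](row_Jac Y s t).1 -row_mul -XY// row_Jac.
  - by rewrite lVl -[pderiv2 Y s t](row_Jac Y s t).2 -row_mul -XY// row_Jac.
  - by have [] := is_derive_mulmxr (invmx L) (derivableP dN1).
  - by have [] := is_derive_mulmxr (invmx L) (derivableP dN2).
have [K [[A wA KA] K0 Kv]] := KN s t st; exists K; split=> //;
  last by rewrite lV.
exists A; last by rewrite lV.
by rewrite /weingarten JN// -mulNmx -wA XY// -mulmxA mulmxK.
Qed.

End RigidMotions.

(** * Surfaces of revolution about the x-axis *)

Section SurfacesOfRevolution.
Variables (R : realType) (I : set R) (f : R -> R).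
Hypotheses (oI : open I) (sf : smooth_on I f) (I_gt0 : I `<=` [set r | 0 < r]).
Implicit Types (r theta : R) (X Y N : R -> R -> 'rV[R]_3).

Local Notation f' := (derive1 f).
Local Notation f'' := (derive1 (derive1 f)).

Lemma is_derive_f r : I r -> is_derive r 1 f (f' r).
Proof. by move=> Ir; rewrite derive1E; exact/derivableP/(@sf 0). Qed.

Lemma is_derive_f' r : I r -> is_derive r 1 f' (f'' r).
Proof.
move=> Ir; rewrite [X in is_derive _ _ _ X]derive1E.
exact/derivableP/(@sf 1).
Qed.

Lemma is_derive_rev_cosh1 r theta : I r ->
  is_derive r 1 (fun r => rev_cosh f r theta)
    (vec3 (f' r) (sinh theta) (cosh theta)).
Proof.
move=> /is_derive_f fr.
exact: is_derive_vec3 fr (is_derive_mulr _ r) (is_derive_mulr _ r).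
Qed.

Lemma is_derive_rev_sinh1 r theta : I r ->
  is_derive r 1 (fun r => rev_sinh f r theta)
    (vec3 (f' r) (cosh theta) (sinh theta)).
Proof.
move=> /is_derive_f fr.
exact: is_derive_vec3 fr (is_derive_mulr _ r) (is_derive_mulr _ r).
Qed.

Lemma is_derive_rev_cosh2 r theta :
  is_derive theta 1 (rev_cosh f r) (vec3 0 (r * cosh theta) (r * sinh theta)).
Proof.
exact: is_derive_vec3 (is_derive_cst (f r) theta 1)
  (is_deriveZ r (is_derive_sinh theta)) (is_deriveZ r (is_derive_cosh theta)).
Qed.

Lemma is_derive_rev_sinh2 r theta :
  is_derive theta 1 (rev_sinh f r) (vec3 0 (r * sinh theta) (r * cosh theta)).
Proof.
exact: is_derive_vec3 (is_derive_cst (f r) theta 1)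
  (is_deriveZ r (is_derive_cosh theta)) (is_deriveZ r (is_derive_sinh theta)).
Qed.

Lemma Jac_motion X Y (o : 'rV[R]_3) (L : 'M[R]_3) r theta :
  derivable (fun r => Y r theta) r 1 -> derivable (Y r) theta 1 ->
  (forall r theta, I r -> X r theta = o + Y r theta *m L) -> I r ->
  Jac X r theta = Jac Y r theta *m L.
Proof.
move=> /derivableP dY1 /derivableP dY2 XY Ir; apply: Jac_mulmx.
- rewrite /pderiv1 [in RHS]derive1E derive1E.
  (* The formula for [X] holds only for parameters in [I], so the derivative in [r] uses that [I] is
     a neighbourhood of [r]. In the angle it holds everywhere. *)
  rewrite (near_eq_derive _ (g := cst o + (fun r => Y r theta *m L))).
    have := is_deriveD (is_derive_cst o r 1) (is_derive_mulmxr L dY1).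
    by rewrite add0r => ?; rewrite derive_val.
  by near=> z; apply: XY; near: z; exact: open_nbhs_nbhs.
- rewrite /pderiv2 [in RHS]derive1E derive1E.
  rewrite (_ : (fun t => _) = cst o + (fun t => Y r t *m L)).
    have := is_deriveD (is_derive_cst o theta 1) (is_derive_mulmxr L dY2).
    by rewrite add0r => ?; rewrite derive_val.
  by apply/funext => t; exact: XY.
Unshelve. all: by end_near. Qed.

Lemma pderiv1_rev_cosh r theta : I r ->
  pderiv1 (rev_cosh f) r theta = vec3 (f' r) (sinh theta) (cosh theta).
Proof. by move=> Ir; exact: derive1_val (is_derive_rev_cosh1 _ Ir). Qed.

Lemma pderiv2_rev_cosh r theta :
  pderiv2 (rev_cosh f) r theta = vec3 0 (r * cosh theta) (r * sinh theta).
Proof. exact: derive1_val (is_derive_rev_cosh2 r theta). Qed.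

Lemma rev_cosh_spacelike r : I r ->
  spacelike (rev_domain I) (rev_cosh f) -> 1 < f' r ^+ 2.
Proof.
(* At angle 0 the tangent vector X_r has square norm f'^2 - 1. *)
move=> Ir sp; have := sp r 0 (conj Ir Logic.I) (delta_mx 0 0).
rewrite -rowE row_Jac pderiv1_rev_cosh// /mink !vec3E sinh0 cosh0.
have -> : delta_mx 0 0 != 0 :> 'rV[R]_2.
  by apply/eqP => /rowP/(_ 0); rewrite !mxE/=; apply/eqP; rewrite oner_eq0.
by move=> /(_ isT); lra.
Qed.

Lemma rev_sinh_not_spacelike : I !=set0 ->
  ~ spacelike (rev_domain I) (rev_sinh f).
Proof.
(* At angle 0 the tangent vector X_theta is (0, 0, r), of square norm - r^2. *)
move=> [r Ir] sp; have := sp r 0 (conj Ir Logic.I) (delta_mx 0 1).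
rewrite -rowE row_Jac /pderiv2 (derive1_val (is_derive_rev_sinh2 r 0)).
rewrite /mink !vec3E sinh0 cosh0.
have -> : delta_mx 0 1 != 0 :> 'rV[R]_2.
  by apply/eqP => /rowP/(_ 1); rewrite !mxE/=; apply/eqP; rewrite oner_eq0.
by move=> /(_ isT); nra.
Qed.

(** Orthogonality to X_r and X_theta is a linear system for the last two components of N, with
    determinant cosh^2 - sinh^2 = 1 up to the factor r. Normalization then gives the third
    identity. *)
Lemma rev_cosh_normal N r theta : unit_normal (rev_domain I) (rev_cosh f) N ->
  I r ->
  [/\ N r theta 0 1 = N r theta 0 0 * (f' r * sinh theta),
      N r theta 0 2 = N r theta 0 0 * (f' r * cosh theta) &
      N r theta 0 0 ^+ 2 * (f' r ^+ 2 - 1) = 1].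
Proof.
move=> nN Ir; have r0 := I_gt0 Ir.
have [+ + + _ _] := nN r theta (conj Ir Logic.I).
rewrite pderiv1_rev_cosh// pderiv2_rev_cosh /mink !vec3E.
have := cosh2B_sinh2 theta.
move: (cosh theta) (sinh theta) (N r theta 0 0) (N r theta 0 1) (N r theta 0 2).
move=> c s n0 n1 n2 cs NN N1 N2.
have /(mulfI (lt0r_neq0 r0)) N2' : r * (n1 * c) = r * (n2 * s) by lra.
have n1E : n1 = n0 * (f' r * s).
  have : n1 * (c ^+ 2 - s ^+ 2) = n0 * (f' r * s).
    have -> : n1 * (c ^+ 2 - s ^+ 2) = n1 * c * c - n1 * s * s by ring.
    by rewrite N2'; have := congr1 (fun z => s * z) N1; lra.
  by rewrite cs mulr1.
have n2E : n2 = n0 * (f' r * c).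
  have : n2 * (c ^+ 2 - s ^+ 2) = n0 * (f' r * c).
    have -> : n2 * (c ^+ 2 - s ^+ 2) = n2 * c * c - n2 * s * s by ring.
    by rewrite -N2'; have := congr1 (fun z => c * z) N1; lra.
  by rewrite cs mulr1.
split=> //; move: NN; rewrite n1E n2E.
by have := congr1 (fun z => (n0 * f' r) ^+ 2 * z) cs; lra.
Qed.

(** For fixed r the square of n = [N r t 0 0] is the constant 1 / (f'^2 - 1), so 2 n n_theta = 0,
    and n is nonzero. *)
Lemma is_derive_rev_cosh_normal2 N r theta :
  unit_normal (rev_domain I) (rev_cosh f) N -> I r ->
  is_derive theta 1 (fun t => N r t 0 0) 0.
Proof.
move=> nN Ir; have [_ _ nt] := rev_cosh_normal theta nN Ir.
have W0 : f' r ^+ 2 - 1 != 0.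
  by apply: contra_eqN nt => /eqP ->; rewrite mulr0 eq_sym oner_eq0.
have [_ _ _ _ /derivable_mxP/(_ 0 0)/derivableP dn] :=
  nN r theta (conj Ir Logic.I).
have dn2 : is_derive theta 1 ((fun t => N r t 0 0) * (fun t => N r t 0 0)) 0.
  rewrite (_ : _ * _ = cst (f' r ^+ 2 - 1)^-1); first exact: is_derive_cst.
  apply/funext => u; have [_ _ nu] := rev_cosh_normal u nN Ir.
  by apply: (mulIf W0); rewrite mulVf// -nu expr2.
suff <- : 'D_1 (fun t => N r t 0 0) theta = 0 by [].
have := is_derive_unique (is_deriveM dn dn) dn2.
rewrite /GRing.scale/= -mulrDr => /eqP; rewrite mulf_eq0 => /orP[/eqP n0|].
  by move: nt; rewrite n0 expr0n mul0r => /esym/eqP; rewrite oner_eq0.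
by move/eqP; lra.
Qed.

Lemma rev_cosh_normal_cst N r theta theta' :
  unit_normal (rev_domain I) (rev_cosh f) N -> I r ->
  N r theta 0 0 = N r theta' 0 0.
Proof.
move=> nN Ir; apply: (is_derive_0_is_cst (f := fun t => N r t 0 0)) => t.
exact: is_derive_rev_cosh_normal2.
Qed.

(* Writing n for the component of N along the axis, n_theta = 0 and the first
   column of the Weingarten equation make A triangular. *)
Lemma rev_cosh_curvature N r theta K :
  unit_normal (rev_domain I) (rev_cosh f) N -> I r ->
  gauss_curvature (rev_cosh f) N r theta K ->
  K = f' r * f'' r / (r * (f' r ^+ 2 - 1) ^+ 2).
Proof.
move=> nN Ir [A wA ->]; have r0 := I_gt0 Ir.
have [-> _ _ dN1 dN2] := nN r theta (conj Ir Logic.I).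
have [_ _ nn] := rev_cosh_normal theta nN Ir.
have W0 : f' r ^+ 2 - 1 != 0.
  by apply: contra_eqN nn => /eqP ->; rewrite mulr0 eq_sym oner_eq0.
have dn : is_derive r 1 (fun r => N r theta 0 0) (pderiv1 N r theta 0 0).
  exact: (is_derive1_entry 0 0 dN1).
set p := pderiv1 N r theta 0 0 in dn.
set n := N r theta 0 0 in nn.
(* Differentiate n^2 (f'^2 - 1) = 1 in r and divide by 2 n. The identity holds on the open set [I],
   hence near r. *)
have pE : p * (f' r ^+ 2 - 1) = - (n * f' r * f'' r).
  have nW : is_derive r 1 ((fun r => N r theta 0 0) * (fun r => N r theta 0 0) *
      (f' * f' - cst 1)) 0.
    apply: (@near_eq_is_derive _ _ _ (cst (1 : R)) _ r 1 0 _
      (is_derive_cst (1 : R) r 1)).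
    near=> z; have Iz : I z by near: z; exact: open_nbhs_nbhs.
    have [_ _ nz] := rev_cosh_normal theta nN Iz.
    by apply: etrans (esym nz) _; rewrite !expr2.
  have df' := is_derive_f' Ir.
  have := is_derive_unique (is_deriveM (is_deriveM dn dn)
    (is_deriveB (is_deriveM df' df') (is_derive_cst (1 : R) r 1))) nW.
  rewrite /GRing.scale/= -/n => e.
  have n0 : n != 0.
    by apply: contra_eqN nn => /eqP ->; rewrite expr0n mul0r eq_sym oner_eq0.
  apply: (mulfI n0); move: e.
  rewrite -[X in X * _ + _]/(n * n) -[X in _ + X * _]/(f' r * f' r - 1).
  lra.
have dN20 : is_derive theta 1 (fun t => N r t 0 0) (pderiv2 N r theta 0 0).
  exact: (is_derive1_entry 0 0 dN2).
have dN21 : is_derive theta 1 (fun t => N r t 0 1) (pderiv2 N r theta 0 1).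
  exact: (is_derive1_entry 0 1 dN2).
have dn0 : pderiv2 N r theta 0 0 = 0.
  exact: is_derive_unique dN20 (is_derive_rev_cosh_normal2 _ nN Ir).
(* As n does not depend on the angle, only the factor sinh in n f' sinh is differentiated. *)
have dn1 : pderiv2 N r theta 0 1 = n * (f' r * cosh theta).
  apply: is_derive_unique dN21 _.
  rewrite (_ : (fun t => _) = (n * f' r) \*: @sinh R).
    have := is_deriveZ (n * f' r) (is_derive_sinh theta).
    by rewrite /GRing.scale/= -mulrA.
  apply/funext => t; have [-> _ _] := rev_cosh_normal t nN Ir.
  by rewrite (rev_cosh_normal_cst t theta nN Ir) mulrA.
have e i j : A i 0 * pderiv1 (rev_cosh f) r theta 0 j +
    A i 1 * pderiv2 (rev_cosh f) r theta 0 j = - Jac N r theta i j.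
  have /matrixP/(_ i j) := wA; rewrite mxE sum_ord2 !JacE => ->.
  by rewrite mxE.
(* If f' = 0, the normalization would read - n^2 = 1. *)
have F0 : f' r != 0.
  by apply: contra_eqN nn => /eqP ->; rewrite lt_eqF//; have := sqr_ge0 n; lra.
(* These entries read A00 f' = - n_r, then A10 f' = 0, and, once A10 = 0, A11 r cosh = - n f'
   cosh. *)
move: (e 0 0) (e 1 0) (e 1 1).
rewrite pderiv1_rev_cosh// pderiv2_rev_cosh !JacE !vec3E dn0 dn1 -/p det_mx2.
rewrite !mulr0 !addr0 oppr0 => e00 /eqP.
rewrite mulf_eq0 (negPf F0) orbF => /eqP -> e11.
have dE : A 1 1 * r = - (n * f' r).
  by apply: (mulIf (lt0r_neq0 (cosh_gt0 theta))); lra.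
have aE : A 0 0 * (f' r ^+ 2 - 1) = n * f'' r.
  apply: (mulfI F0); have := congr1 ( *%R^~ (f' r ^+ 2 - 1)) e00.
  by rewrite mulNr pE; lra.
have rW0 : r * (f' r ^+ 2 - 1) ^+ 2 != 0.
  by rewrite mulf_neq0 ?expf_neq0//; exact: lt0r_neq0.
apply: (mulIf rW0); rewrite divfK//.
(* The factor n^2 (f'^2 - 1) = 1 is inserted to match the product of the two diagonal entries, each
   of which contributes one n. *)
transitivity (f' r * f'' r * (n ^+ 2 * (f' r ^+ 2 - 1))); last first.
  by rewrite nn mulr1.
transitivity (- (A 0 0 * (f' r ^+ 2 - 1)) * (A 1 1 * r) * (f' r ^+ 2 - 1)).
  by ring.
by rewrite aE dE; ring.
Unshelve. all: by end_near. Qed.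

Lemma rev_cosh_translator (alpha : R) (w : 'rV[R]_3) : I !=set0 ->
  spacelike (rev_domain I) (rev_cosh f) ->
  K_translator (rev_domain I) (rev_cosh f) alpha w ->
  w 0 1 = 0 /\ w 0 2 = 0.
Proof.
move=> [r Ir] sp [N [nN KN]].
have F1 := rev_cosh_spacelike Ir sp.
have [_ _ nn] := rev_cosh_normal 0 nN Ir.
have n0 : N r 0 0 0 * f' r != 0.
  rewrite mulf_neq0//; last by apply: contraTneq F1 => ->; rewrite -leNgt; lra.
  by apply: contra_eqN nn => /eqP ->; rewrite expr0n mul0r eq_sym oner_eq0.
(* The curvature formula is free of the angle, so the translator equations at t and at 0 have equal
   left sides. Cancelling n f' leaves this identity. *)
have cst_t t : sinh t * w 0 1 - cosh t * w 0 2 = - w 0 2.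
  have [K [/(rev_cosh_curvature nN Ir) -> _]] := KN r t (conj Ir Logic.I).
  have [K0 [/(rev_cosh_curvature nN Ir) -> _ ->]] := KN r 0 (conj Ir Logic.I).
  rewrite /mink.
  have [-> -> _] := rev_cosh_normal t nN Ir.
  have [-> -> _] := rev_cosh_normal 0 nN Ir.
  rewrite (rev_cosh_normal_cst t 0 nN Ir) sinh0 cosh0 => e.
  by apply: (mulfI n0); lra.
(* At t = ln 2 and t = - ln 2, cosh is 5/4 and sinh is 3/4 and - 3/4. The two instances form an
   invertible linear system in [w 0 1] and [w 0 2]. *)
have e2 : expR (ln 2) = 2 :> R by rewrite lnK// posrE.
have := cst_t (ln 2); have := cst_t (- ln 2).
by rewrite /sinh /cosh opprK expRN e2; split; lra.
Qed.

End SurfacesOfRevolution.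

(** * Reduction of an arbitrary spacelike axis to the x-axis *)

Theorem proposition3p6 (R : realType) (alpha : R) (v : 'rV[R]_3)
    (o a : 'rV[R]_3) (I : set R) (X : R -> R -> 'rV[R]_3) :
  alpha != 0 ->
  revolution_surface o a I X ->
  spacelike (rev_domain I) X ->
  K_translator (rev_domain I) X alpha v ->
  parallel v a.
Proof.
move=> _ [oI _ I0 I_gt0 [L [f [lL -> sf XE]]]] sX tX.
have uL := lorentz_unitmx lL.
case: XE => XE.
- have JX r theta : rev_domain I (r, theta) ->
      Jac X r theta = Jac (rev_cosh f) r theta *m L.
    move=> [/= Ir _]; apply: (Jac_motion oI _ _ XE Ir).
    + by have [] := is_derive_rev_cosh1 sf theta Ir.
    + by have [] := is_derive_rev_cosh2 f r theta.
  have [w1 w2] := rev_cosh_translator oI sf I_gt0 I0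
    (spacelike_mulmx lL JX sX) (K_translator_mulmx lL JX tX).
  (* The speed carried back to the x-axis has only its first coordinate left; that coordinate is the
     ratio, and applying [L] returns to [v] and the given axis. *)
  exists ((v *m invmx L) 0 0).
  rewrite -[LHS](mulmxKV uL) scalemxAl; congr (_ *m L).
  by apply: rV3_eq; rewrite [RHS]mxE vec3E ?mulr1 ?mulr0.
- have JX r theta : rev_domain I (r, theta) ->
      Jac X r theta = Jac (rev_sinh f) r theta *m L.
    move=> [/= Ir _]; apply: (Jac_motion oI _ _ XE Ir).
    + by have [] := is_derive_rev_sinh1 sf theta Ir.
    + by have [] := is_derive_rev_sinh2 f r theta.
  (* The second kind contradicts spacelikeness, which [L] preserves. *)
  by case: (rev_sinh_not_spacelike I0 (spacelike_mulmx lL JX sX)).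
Qed.
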